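(* Let $\Pi\subseteq S_m$ be a set of generalized permutation patterns, all with the same number $b$ of blocks. Then the packing density of $\Pi$ on words is equal to that on permutations, i.e. $$\delta(\Pi)=\lim_{n\to\infty}\frac{\max\{\nu(\Pi,\sigma):\sigma\in S_n\}}{\binom{n-m+b}{b}}.$$
   Context: $[k]=\{1,\dots,k\}$ and $[k]^n$ is the set of words of length $n$ over $[k]$; permutations in $S_n$ are regarded as words in $[n]^n$ with distinct letters. Two words $u,v$ of the same length are order-isomorphic if for all positions $i,j$: $u_i<u_j\iff v_i<v_j$. A generalized pattern of length $m$ is a word of length $m$ in which a hyphen may or may not be placed between each two adjacent letters; it has $b$ blocks if it has $b-1$ hyphens. A generalized permutation pattern is one whose underlying word is a permutation in $S_m$ (written, with abuse of notation, as an element of $S_m$). An occurrence of a generalized pattern $\pi$ in a word $\sigma$ is a choice of positions $i_1<\dots<i_m$ such that the subsequence of $\sigma$ at these positions is order-isomorphic to the underlying word of $\pi$ and $i_{j+1}=i_j+1$ whenever there is no hyphen between the $j$th and $(j+1)$st letters of $\pi$. (E.g. an occurrence of $21\text{-}3$ is a subsequence $a_ia_{i+1}a_j$ with $a_{i+1}<a_i<a_j$, $j>i+1$.) For a set $\Pi$ of generalized patterns of length $m$ with $b$ blocks, $\nu(\Pi,\sigma)$ is the total number of occurrences in $\sigma$ of patterns in $\Pi$, $\mu(\Pi,k,n)=\max\{\nu(\Pi,\sigma):\sigma\in[k]^n\}$, $\delta(\Pi,k,n)=\mu(\Pi,k,n)/\binom{n-m+b}{b}$ for $n\ge m$, and the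 packing density (on words) is $\delta(\Pi)=\lim_{n\to\infty}\lim_{k\to\infty}\delta(\Pi,k,n)=\lim_{n\to\infty}\delta(\Pi,n,n)$ (for $k\ge n$, $\delta(\Pi,k,n)=\delta(\Pi,n,n)$). *)

(* Defs.v *)
From mathcomp Require Import all_boot all_order all_algebra perm.
From mathcomp Require Import all_classical all_reals all_analysis.
Set Implicit Arguments.
Unset Strict Implicit.
Unset Printing Implicit Defensive.

Import Order.TTheory GRing.Theory Num.Theory.
Import numFieldNormedType.Exports.

(* [k]^n; positions and letters are numbered from 0. *)
Definition word (k n : nat) : finType := {ffun 'I_n -> 'I_k}.

Definition perm_word n (s : 'S_n) : word n n := [ffun i => s i].

Definition order_iso k l n (u : word k n) (v : word l n) : bool :=
  [forall i : 'I_n, forall j : 'I_n, (u i < u j)%N == (v i < v j)%N].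

(* A word together with the set of its hyphens: h in the second component means
   a hyphen between the letters of (0-based) indices h and h.+1.  Only the
   relative order of the letters matters, so the alphabet [m] suffices for
   patterns of length m. *)
Definition gpattern (m : nat) : finType := (word m m * {set 'I_m.-1})%type.

Definition pat_word m (p : gpattern m) : word m m := p.1.
Definition hyphens m (p : gpattern m) : {set 'I_m.-1} := p.2.

Definition nblocks m (p : gpattern m) : nat := #|hyphens p|.+1.

Definition perm_pattern m (p : gpattern m) : bool :=
  [exists s : 'S_m, pat_word p == perm_word s].

Definition subword k n m (s : word k n) (f : {ffun 'I_m -> 'I_n}) : word k m :=
  [ffun j => s (f j)].

(* The positions i_1 < ... < i_m are the values f 0 < ... < f m.-1. *)
Definition occurrence m k n (p : gpattern m) (s : word k n)
    (f : {ffun 'I_m -> 'I_n}) : bool :=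
  [&& [forall i : 'I_m, forall j : 'I_m, (i < j)%N ==> (f i < f j)%N],
      order_iso (subword s f) (pat_word p)
    & [forall h : 'I_m.-1, (h \notin hyphens p) ==>
        [forall i : 'I_m, forall j : 'I_m,
          ((i == h :> nat) && (j == h.+1 :> nat)) ==> (f j == (f i).+1 :> nat)]]].

Definition nu m k n (Pi : {set gpattern m}) (s : word k n) : nat :=
  \sum_(p in Pi) #|[pred f | occurrence p s f]|.

Definition mu m (Pi : {set gpattern m}) (k n : nat) : nat :=
  \max_(s : word k n) nu Pi s.

Definition mu_perm m (Pi : {set gpattern m}) (n : nat) : nat :=
  \max_(s : 'S_n) nu Pi (perm_word s).

Local Open Scope ring_scope.
Local Open Scope classical_set_scope.

(* b is the common number of blocks of the patterns in Pi; the value is only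
   meaningful for m <= n, since the subtraction is truncated. *)
Definition delta (R : realType) m (Pi : {set gpattern m}) (b k n : nat) : R :=
  (mu Pi k n)%:R / 'C(n - m + b, b)%:R.

Definition delta_perm (R : realType) m (Pi : {set gpattern m}) (b n : nat) : R :=
  (mu_perm Pi n)%:R / 'C(n - m + b, b)%:R.

Definition packing_density (R : realType) m (Pi : {set gpattern m}) (b : nat) : R :=
  limn (fun n => limn (fun k => delta R Pi b k n)).

(* Main.v *)
Require Import Defs.
From mathcomp Require Import all_boot all_order all_algebra perm.
From mathcomp Require Import all_classical all_reals all_analysis.
From mathcomp Require Import zify ring lra.
Import Order.TTheory GRing.Theory Num.Theory.
Import numFieldNormedType.Exports.
Set Implicit Arguments.
Unset Strict Implicit.
Unset Printing Implicit Defensive.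
Local Open Scope nat_scope.

(** Two independent facts give the theorem.

    Repeated letters never help a permutation pattern.  Breaking the ties of a
    word turns it into a permutation without reversing any strict inequality
    between letters, and an occurrence of a permutation pattern only asks for
    strict inequalities ([standardization], [nu_le]).  Hence the maximum over
    words equals the maximum over permutations as soon as the alphabet has n
    letters ([mu_eq_mu_perm]), and the inner limit is that of an eventually
    constant sequence.

    The densities a(n) on permutations converge.  They need not be monotone
    (with a single block they behave like the quotients in Fekete's lemma), but
    they almost decrease: for every e > 0 and every large enough n, all but
    finitely many N satisfy a(N) <= (1 + e) a(n).  This is proved by sampling.
    In a long word, take the windows of W = L + m letters that start at the
    multiples of L: whatever its first letter, a block has at most m letters and
    so lies inside a window.  Choose a multiset of t windows and
    concatenate them in order; the result is a word of length t W, in which an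
    occurrence survives as soon as the multiset contains the windows of its b
    blocks, with multiplicity ([occurrence_sample]).  Allowing multisets is what
    makes this exact: two blocks in the same window are sent to two copies of
    it, so no exceptional occurrence has to be estimated.  With Q + 1 windows
    there are C(t + Q, Q) multisets, of which at least C(t - b + Q, Q) contain
    a prescribed one of size b.  Averaging over them yields
    mu(N) C(t, b) <= mu(n) C(t + Q, b) for n >= t W and Q = N %/ L
    ([mu_perm_sampling]).  Choosing L large, then n and t = n %/ W large, then N
    large, makes the ratio of the normalisations close to 1
    ([delta_perm_almost_decr]), and a nonnegative sequence that almost decreases
    converges to the infimum of its eventual upper bounds
    ([cvgn_almost_decr]). *)

(** * Words and permutations *)

(** Equal letters are ordered by their positions: each position is sent to its
    rank for the lexicographic order on pairs (letter, position). *)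
Lemma standardization k n (s : word k n) :
  exists sg : 'S_n, forall i j : 'I_n, s i < s j -> sg i < sg j.
Proof.
pose lex (j i : 'I_n) := (s j < s i) || ((s j == s i :> nat) && (j < i)).
pose below (i : 'I_n) := [set j | lex j i].
have lexxx i : lex i i = false by rewrite /lex; lia.
have rank_lt i : #|below i| < n.
  rewrite -[X in _ < X]card_ord -cardsT; apply: proper_card.
  by apply/properP; split; [exact: finset.subsetT | exists i; rewrite // inE lexxx].
pose rank i := Ordinal (rank_lt i).
have rank_mono i j : lex i j -> rank i < rank j.
  move=> ij; apply: proper_card; apply/properP; split.
    by apply/fintype.subsetP=> l; rewrite !inE; move: ij; rewrite /lex; lia.
  by exists i; rewrite !inE ?lexxx.
have rank_inj : injective rank.
  move=> i j eq_ij; apply/eqP/negP => /negP ne_ij.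
  have [/rank_mono|/rank_mono] : lex i j \/ lex j i.
  - by apply/orP; move: ne_ij; rewrite -val_eqE /lex /=; lia.
  - by rewrite eq_ij ltnn.
  - by rewrite eq_ij ltnn.
exists (perm rank_inj) => i j ij; rewrite !permE; apply: rank_mono.
by rewrite /lex ij.
Qed.

Lemma perm_pattern_inj m (p : gpattern m) :
  perm_pattern p -> forall i j : 'I_m, pat_word p i = pat_word p j -> i = j.
Proof.
by case/existsP=> s /eqP-> i j; rewrite !ffunE => /perm_inj.
Qed.

(** Since [u] has distinct letters, being order-isomorphic to [u] amounts to a
    list of strict inequalities, one for each pair of positions. *)
Lemma order_iso_refine k l n d (s : word k n) (s' : word l n)
    (f : {ffun 'I_d -> 'I_n}) (u : word d d) :
    (forall i j, s i < s j -> s' i < s' j) ->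
    (forall i j, u i = u j -> i = j) ->
  order_iso (subword s f) u -> order_iso (subword s' f) u.
Proof.
move=> ss' u_inj /forallP iso; apply/forallP=> i; apply/forallP=> j.
have isoE x y : (s (f x) < s (f y)) = (u x < u y).
  by have /forallP/(_ y)/eqP := iso x; rewrite !ffunE.
have lift x y : u x < u y -> s' (f x) < s' (f y) by rewrite -isoE => /ss'.
rewrite !ffunE; apply/eqP; case: (ltngtP (u i) (u j)) => [/lift//|/lift|].
  by move=> /ltnW; rewrite leqNgt => /negbTE.
by move/val_inj/u_inj->; rewrite ltnn.
Qed.

Lemma nu_le m k l n (Pi : {set gpattern m}) (s : word k n) (s' : word l n) :
    (forall p, p \in Pi -> perm_pattern p) ->
    (forall i j, s i < s j -> s' i < s' j) ->
  nu Pi s <= nu Pi s'.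
Proof.
move=> Pi_perm ss'; apply: leq_sum => p pPi; apply/subset_leq_card/fintype.subsetP => f.
rewrite !inE => /and3P[incr iso adj]; apply/and3P; split=> //.
by apply: order_iso_refine iso => //; exact/perm_pattern_inj/Pi_perm.
Qed.

Lemma nu_le_mu_perm m k n (Pi : {set gpattern m}) (s : word k n) :
    (forall p, p \in Pi -> perm_pattern p) ->
  nu Pi s <= mu_perm Pi n.
Proof.
move=> Pi_perm; have [sg sgP] := standardization s.
apply: leq_trans (leq_bigmax sg); apply: nu_le => // i j /sgP.
by rewrite !ffunE.
Qed.

Lemma mu_eq_mu_perm m k n (Pi : {set gpattern m}) :
    (forall p, p \in Pi -> perm_pattern p) -> n <= k ->
  mu Pi k n = mu_perm Pi n.
Proof.
move=> Pi_perm le_nk; apply/eqP; rewrite eqn_leq; apply/andP; split.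
  by apply/bigmax_leqP => s _; exact: nu_le_mu_perm.
apply/bigmax_leqP => sg _.
apply: leq_trans (leq_bigmax ([ffun i => widen_ord le_nk (sg i)] : word k n)).
by apply: nu_le => // i j; rewrite !ffunE.
Qed.

(** * Increasing embeddings and their blocks *)

(** Index of the block of [p] that contains its letter [i]. *)
Definition block m (p : gpattern m) (i : nat) : nat :=
  #|[set h in hyphens p | h < i]|.

(** Distance of a chosen position from the leftmost place it could take.  Along
    an occurrence it never decreases and is constant on each block, so it
    locates a block without singling out its first letter. *)
Definition excess m n (f : {ffun 'I_m -> 'I_n}) (i : 'I_m) : nat := f i - i.

(** The window to which the block of index [j] is attached.  Taking the maximum
    over all blocks up to [j] makes the sequence visibly monotone; by
    monotonicity of the excess, this is also the value on block [j] itself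
    ([profile_block]). *)
Definition profile m n (p : gpattern m) (f : {ffun 'I_m -> 'I_n}) (L j : nat) :=
  \max_(i < m | block p i <= j) excess f i %/ L.

Section Profile.
Context {m n : nat}.
Variables (p : gpattern m) (f : {ffun 'I_m -> 'I_n}).
Hypothesis f_incr : forall i j : 'I_m, i < j -> f i < f j.
Hypothesis f_adj : forall (h : 'I_m.-1) (i j : 'I_m),
  h \notin hyphens p -> i = h :> nat -> j = h.+1 :> nat -> f j = (f i).+1 :> nat.

Lemma block_lt i : block p i < nblocks p.
Proof.
by rewrite ltnS; apply/subset_leq_card/fintype.subsetP=> h; rewrite inE => /andP[].
Qed.

Lemma block_mono i j : i <= j -> block p i <= block p j.
Proof.
move=> ij; apply/subset_leq_card/fintype.subsetP=> h; rewrite !inE => /andP[-> /=].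
by move/leq_trans; apply.
Qed.

Lemma incr_gap (i j : 'I_m) : i <= j -> f i + (j - i) <= f j.
Proof.
case: j => j lt_j /=; elim: j lt_j => [|j IH] lt_j.
  rewrite leqn0 => i0; have -> : i = Ordinal lt_j by apply/val_inj/eqP.
  by rewrite addn0.
rewrite leq_eqVlt => /orP[/eqP ei|lt_ij].
  have -> : i = Ordinal lt_j by exact/val_inj.
  by rewrite subnn addn0.
have := IH (ltnW lt_j) lt_ij.
have := @f_incr (Ordinal (ltnW lt_j)) (Ordinal lt_j) (ltnSn _).
by lia.
Qed.

Lemma excessK (i : 'I_m) : excess f i + i = f i.
Proof.
rewrite subnK //; have m_gt0 : 0 < m by case: i => ? /=; lia.
by have := @incr_gap (Ordinal m_gt0) i (leq0n _) => /=; lia.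
Qed.

Lemma excess_mono (i j : 'I_m) : i <= j -> excess f i <= excess f j.
Proof.
by move=> ij; have := incr_gap ij; have := excessK i; have := excessK j; lia.
Qed.

(** Two positions of the same block have no hyphen between them, so the
    occurrence advances by exactly one at each step from one to the other. *)
Lemma excess_block (i j : 'I_m) :
  i <= j -> block p i = block p j -> excess f i = excess f j.
Proof.
case: j => j lt_j /=; elim: j lt_j => [|j IH] lt_j.
  rewrite leqn0 => i0; have -> // : i = Ordinal lt_j by apply/val_inj/eqP.
rewrite leq_eqVlt => /orP[/eqP ei _|lt_ij eq_b].
  by have -> // : i = Ordinal lt_j by exact/val_inj.
have lt_j' : j < m.-1 by lia.
pose h := Ordinal lt_j'; pose jo := Ordinal (ltnW lt_j).
have eq_b1 : block p i = block p j.
  apply/eqP; rewrite eqn_leq block_mono // eq_b block_mono //.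
have := block_mono (leqnSn j); rewrite leq_eqVlt => /orP[/eqP eqj|]; last lia.
have hNh : h \notin hyphens p.
  apply/negP=> hh; suff : block p j < block p j.+1 by rewrite eqj ltnn.
  apply: proper_card; apply/properP; split; last first.
    by exists h; rewrite !inE hh ?ltnSn ?ltnn.
  apply/fintype.subsetP=> l; rewrite !inE => /andP[-> /= ]; exact: ltnW.
rewrite (IH (ltnW lt_j)) //.
by rewrite /excess (@f_adj h jo (Ordinal lt_j) hNh erefl erefl) subSS.
Qed.

Lemma profile_mono L i j : i <= j -> profile p f L i <= profile p f L j.
Proof.
move=> ij; apply/bigmax_leqP => l bl; apply: leq_bigmax_cond.
exact: leq_trans ij.
Qed.

Lemma profile_le L j : profile p f L j <= n %/ L.
Proof.
apply/bigmax_leqP => l _; apply: leq_div2r.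
by rewrite (leq_trans (leq_subr _ _)) // ltnW.
Qed.

Lemma profile_block L (i : 'I_m) : profile p f L (block p i) = excess f i %/ L.
Proof.
apply/eqP; rewrite eqn_leq; apply/andP; split; last exact: leq_bigmax_cond.
apply/bigmax_leqP => l bl; apply: leq_div2r.
case: (leqP l i) => [/excess_mono //|/ltnW il].
rewrite -(excess_block il) //.
by apply/eqP; rewrite eqn_leq bl andbT block_mono.
Qed.

End Profile.

Lemma occurrenceP m k n (p : gpattern m) (s : word k n)
    (f : {ffun 'I_m -> 'I_n}) :
  reflect [/\ forall i j : 'I_m, i < j -> f i < f j,
              order_iso (subword s f) (pat_word p)
            & forall (h : 'I_m.-1) (i j : 'I_m), h \notin hyphens p ->
                i = h :> nat -> j = h.+1 :> nat -> f j = (f i).+1 :> nat]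
          (occurrence p s f).
Proof.
apply: (iffP and3P) => [[incr iso adj]|[incr iso adj]]; split=> //.
- by move=> i j; have /forallP/(_ j)/implyP := forallP incr i.
- move=> h i j hN eih ejh; apply/eqP.
  have /forallP/(_ i)/forallP/(_ j) := implyP (forallP adj h) hN.
  by rewrite eih ejh !eqxx.
- by apply/forallP=> i; apply/forallP=> j; apply/implyP; exact: incr.
- apply/forallP=> h; apply/implyP=> hN; apply/forallP=> i; apply/forallP=> j.
  by apply/implyP=> /andP[/eqP eih /eqP ejh]; apply/eqP; exact: adj hN eih ejh.
Qed.

(** * Sampling windows *)

(** The embedding of a subsequence, as an increasing map on indices. *)
Lemma subseq_nth_incr (T : eqType) (x0 : T) (s1 s2 : seq T) :
  subseq s1 s2 -> exists g : nat -> nat,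
    [/\ forall i j, i < j < size s1 -> g i < g j,
        forall i, i < size s1 -> g i < size s2
      & forall i, i < size s1 -> nth x0 s2 (g i) = nth x0 s1 i].
Proof.
elim: s2 s1 => [|y s2 IH] [|x s1] //=; try by exists id; split=> //; lia.
case: eqP => [<-|_] /IH [g [incr lt_g nth_g]].
  (* The head [y] is used by the first letter of [s1]; otherwise it is skipped. *)
  exists (fun i => if i is i'.+1 then (g i').+1 else 0); split.
  - by case=> [|i] [|j] //= /andP[ij jn]; rewrite ltnS incr //; lia.
  - by case=> //= i; rewrite !ltnS; exact: lt_g.
  - by case=> //= i; rewrite ltnS; exact: nth_g.
by exists (fun i => (g i).+1); split.
Qed.

(** Position, in the sampled word, of the letter [x] of the concatenation of the
    windows in [T]: letter [x %% W] of the window of rank [x %/ W], which starts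
    at a multiple of [L].  The last windows may run past the end of the word;
    there [inord] gives an arbitrary position, which is harmless because such
    letters can only add to the occurrences inherited from the long word. *)
Definition sampling_pos N (L W : nat) (T : seq nat) (x : nat) : 'I_N.+1 :=
  inord (nth 0 T (x %/ W) * L + x %% W).

Definition sample k N n (L W : nat) (T : seq nat) (s : word k N.+1) : word k n :=
  [ffun x : 'I_n => s (sampling_pos N L W T x)].

(** Each block of the occurrence is moved to the copy of its window provided by
    the subsequence, without changing its place inside the window.  A letter sits
    at offset [excess %% L + i < L + m] in its window, hence the length of the
    windows.  The occurrence is recovered from the new one, so that distinct
    occurrences survive as distinct ones. *)
Lemma occurrence_sample m k N n L (T : seq nat) (p : gpattern m)
    (s : word k N.+1) (f : {ffun 'I_m -> 'I_N.+1}) :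
    0 < L -> size T * (L + m) <= n ->
    occurrence p s f -> subseq (mkseq (profile p f L) (nblocks p)) T ->
  exists2 f' : {ffun 'I_m -> 'I_n},
    occurrence p (sample n L (L + m) T s) f'
    & f = [ffun i => sampling_pos N L (L + m) T (f' i)].
Proof.
move=> L_gt0 le_n /occurrenceP[incr iso adj].
move=> /(subseq_nth_incr 0) [g []]; rewrite size_mkseq => g_incr g_lt g_nth.
set W := L + m in le_n *.
pose off (i : 'I_m) := excess f i %% L + i.
have off_lt i : off i < W.
  by rewrite /off /W; have := ltn_pmod (excess f i) L_gt0; have := ltn_ord i; lia.
pose F (i : 'I_m) := g (block p i) * W + off i.
have W_gt0 : 0 < W by rewrite addn_gt0 L_gt0.
have F_div i : F i %/ W = g (block p i).
  by rewrite divnMDl // divn_small ?addn0.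
have F_mod i : F i %% W = off i by rewrite modnMDl modn_small.
have F_lt i : F i < n.
  apply: leq_trans le_n; rewrite -ltn_divLR // F_div.
  exact/g_lt/block_lt.
have F_pos i : sampling_pos N L W T (F i) = f i.
  apply/val_inj; rewrite /= /sampling_pos F_div F_mod.
  have posE : nth 0 T (g (block p i)) * L + off i = f i.
    rewrite g_nth ?block_lt // nth_mkseq ?block_lt // profile_block //.
    by rewrite addnA -divn_eq excessK.
  by rewrite posE inordK.
have F_adj (h : 'I_m.-1) (i j : 'I_m) : h \notin hyphens p ->
    i = h :> nat -> j = h.+1 :> nat -> F j = (F i).+1.
  move=> hN ei ej.
  have eqb : block p i = block p j.
    congr #|pred_of_set _|; apply/finset.setP=> l; rewrite !inE ei ej ltnS.
    case lh: (l \in hyphens p) => //=; rewrite ltn_neqAle.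
    suff -> : l != h :> nat by [].
    by apply: contraNneq hN => /val_inj <-.
  have eqe : excess f i = excess f j.
    by have := adj h i j hN ei ej; rewrite /excess; lia.
  by rewrite /F /off eqb eqe ei ej !addnS.
have F_incr (i j : 'I_m) : i < j -> F i < F j.
  move=> ij; have := block_mono p (ltnW ij); rewrite leq_eqVlt => /orP[/eqP eqb|ltb].
    by rewrite /F /off eqb (excess_block adj (ltnW ij) eqb) !ltn_add2l.
  have : g (block p i) < g (block p j) by rewrite g_incr // ltb block_lt.
  move=> ltg; rewrite ltnNge; apply/negP => /(leq_div2r W).
  by rewrite !F_div leqNgt ltg.
exists [ffun i => Ordinal (F_lt i)]; last by apply/ffunP=> i; rewrite !ffunE F_pos.
apply/occurrenceP; split.
- by move=> i j; rewrite !ffunE; exact: F_incr.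
- apply: etrans iso; congr order_iso; apply/ffunP=> i.
  by rewrite !ffunE /= F_pos.
- by move=> h i j hN ei ej; rewrite !ffunE /=; exact: F_adj hN ei ej.
Qed.

(** Multisets of size [t] are represented by sorted tuples.  Adding [c] to a
    multiset of size [t - b] is injective and produces a multiset that
    contains [c]. *)
Lemma card_sorted_superseq b t Q (c : seq nat) :
    b <= t -> size c = b -> sorted leq c -> all (leq^~ Q) c ->
  'C(t - b + Q, Q) <= #|[set T : t.-tuple 'I_Q.+1 |
      sorted leq (map val T) && subseq c (map val T)]|.
Proof.
move=> le_bt size_c sort_c c_le.
rewrite -bin_sub ?leq_addl // addnK -card_sorted_tuples.
pose ext (s : (t - b).-tuple 'I_Q.+1) : seq nat := sort leq (map val s ++ c).
have size_ext s : size (ext s) = t.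
  by rewrite size_sort size_cat size_map size_tuple size_c subnK.
have ext_le s : all (leq^~ Q) (ext s).
  rewrite all_sort all_cat c_le andbT; apply/allP=> _ /mapP[x _ ->].
  exact: (ltn_ord x).
pose tup s : t.-tuple 'I_Q.+1 := [tuple inord (nth 0 (ext s) i) | i < t].
have tupE s : map val (tup s) = ext s.
  apply: (@eq_from_nth _ 0); first by rewrite size_map size_tuple size_ext.
  move=> i; rewrite size_map size_tuple => lt_i.
  rewrite (nth_map ord0) ?size_tuple // -(tnth_nth _ _ (Ordinal lt_i)) tnth_mktuple.
  by rewrite [LHS]inordK // ltnS; apply: (allP (ext_le s)); rewrite mem_nth ?size_ext.
rewrite -(card_in_imset (f := tup)).
  apply/subset_leq_card/fintype.subsetP=> _ /imsetP[s _ ->]; rewrite inE tupE.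
  rewrite sort_sorted ?leq_total //=.
  apply: sorted_subseq_sort => //; [exact: leq_total | exact: leq_trans |].
  exact: suffix_subseq.
(* A sorted sequence is determined by its multiset, and [c] can be cancelled. *)
move=> s s'; rewrite !inE => ss ss' eq_t; apply/val_inj/(inj_map val_inj).
apply: (sorted_eq leq_trans anti_leq) => //.
rewrite -(perm_cat2r c) -(perm_sort leq) perm_sym -(perm_sort leq) perm_sym.
by rewrite -/(ext s) -/(ext s') -!tupE eq_t.
Qed.

(** Double counting of the pairs formed by an occurrence in [s] and a multiset of
    windows that contains its profile. *)
Lemma nu_sampling m b k N n L t (Pi : {set gpattern m}) (s : word k N.+1) :
    (forall p, p \in Pi -> perm_pattern p) ->
    (forall p, p \in Pi -> nblocks p = b) ->
    0 < L -> b <= t -> t * (L + m) <= n ->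
  nu Pi s * 'C(t - b + N.+1 %/ L, N.+1 %/ L)
    <= mu_perm Pi n * 'C(t + N.+1 %/ L, N.+1 %/ L).
Proof.
move=> Pi_perm Pi_blocks L_gt0 le_bt le_n; set Q := N.+1 %/ L.
pose tuples := [set T : t.-tuple 'I_Q.+1 | sorted leq (map val T)].
pose prof p f := mkseq (@profile m N.+1 p f L) (nblocks p).
have cardT : #|tuples| = 'C(t + Q, Q).
  by rewrite card_sorted_tuples -bin_sub ?leq_addr // addKn.
have sampled (T : t.-tuple 'I_Q.+1) :
    \sum_(p in Pi) #|[set f | occurrence p s f & subseq (prof p f) (map val T)]|
      <= mu_perm Pi n.
  pose s' := sample n L (L + m) (map val T) s.
  apply: leq_trans (nu_le_mu_perm s' Pi_perm).
  apply: leq_sum => p pPi.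
  rewrite -(cardsE (fun f => occurrence p s' f)).
  apply: leq_trans (leq_imset_card
    (fun f' : {ffun 'I_m -> 'I_n} =>
       [ffun i => sampling_pos N L (L + m) (map val T) (f' i)]) _).
  apply/subset_leq_card/fintype.subsetP=> f; rewrite inE => /andP[occ sub].
  have le_n' : size (map val T) * (L + m) <= n by rewrite size_map size_tuple.
  have [f' occ' ->] := occurrence_sample L_gt0 le_n' occ sub.
  by apply/imsetP; exists f'; rewrite ?inE.
rewrite mulnC [leqRHS]mulnC -cardT -[leqRHS]sum_nat_const.
apply: (@leq_trans (\sum_(T in tuples) \sum_(p in Pi)
    #|[set f | occurrence p s f & subseq (prof p f) (map val T)]|)); last first.
  by apply: leq_sum => T _; exact: sampled.
rewrite exchange_big /= big_distrr /=; apply: leq_sum => p pPi.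
under eq_bigr => T _ do rewrite -sum1dep_card big_mkcondr /=.
rewrite exchange_big /= -sum1_card big_distrr /=.
under [leqLHS]eq_bigl => f do rewrite inE.
apply: leq_sum => f _; rewrite muln1.
rewrite -big_mkcondr /=.
under [leqRHS]eq_bigl => T do rewrite inE.
rewrite sum1dep_card; apply: (leq_trans (@card_sorted_superseq b t Q (prof p f) _ _ _ _)) => //.
- by rewrite size_mkseq Pi_blocks.
- rewrite /prof; apply/(sortedP 0) => i; rewrite size_mkseq => lt_i.
  by rewrite !nth_mkseq ?(ltnW lt_i) //; apply: profile_mono.
- by apply/allP=> _ /mapP[j _ ->]; exact: profile_le.
Qed.

(** Both sides are the trinomial coefficient (t + Q)! / (b! (t - b)! Q!). *)
Lemma bin_trinomial t b Q :
  b <= t -> 'C(t + Q, Q) * 'C(t, b) = 'C(t + Q, b) * 'C(t - b + Q, Q).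
Proof.
move=> le_bt.
have pos : 0 < b`! * (t - b)`! * Q`! by rewrite !muln_gt0 !fact_gt0.
apply/eqP; rewrite -(eqn_pmul2r pos); apply/eqP.
have e1 := @bin_fact (t + Q) Q (leq_addl _ _); rewrite addnK in e1.
have e2 := bin_fact le_bt.
have e3 := @bin_fact (t + Q) b (leq_trans le_bt (leq_addr _ _)).
have e4 := @bin_fact (t - b + Q) Q (leq_addl _ _); rewrite addnK in e4.
have -> : 'C(t + Q, Q) * 'C(t, b) * (b`! * (t - b)`! * Q`!)
    = 'C(t + Q, Q) * (Q`! * ('C(t, b) * (b`! * (t - b)`!))) by ring.
have -> : 'C(t + Q, b) * 'C(t - b + Q, Q) * (b`! * (t - b)`! * Q`!)
    = 'C(t + Q, b) * (b`! * ('C(t - b + Q, Q) * (Q`! * (t - b)`!))) by ring.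
by rewrite e2 e1 e4 addnBAC // e3.
Qed.

Lemma mu_perm_sampling m b N n L t (Pi : {set gpattern m}) :
    (forall p, p \in Pi -> perm_pattern p) ->
    (forall p, p \in Pi -> nblocks p = b) ->
    0 < L -> b <= t -> t * (L + m) <= n -> 0 < N ->
  mu_perm Pi N * 'C(t, b) <= mu_perm Pi n * 'C(t + N %/ L, b).
Proof.
case: N => // N Pi_perm Pi_blocks L_gt0 le_bt le_n _.
set Q := _ %/ L.
have pos : 0 < 'C(t - b + Q, Q) by rewrite bin_gt0 leq_addl.
rewrite -(leq_pmul2r pos) -[leqRHS]mulnA -bin_trinomial // mulnA mulnAC.
rewrite leq_mul2r; apply/orP; right.
have [|sg sgE] := @bigop.eq_bigmax _ (fun sg : 'S_N.+1 => nu Pi (perm_word sg)).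
  by apply/card_gt0P; exists 1%g.
rewrite [mu_perm Pi N.+1]sgE.
exact: nu_sampling.
Qed.

(** * Convergence of the densities *)

Lemma ffact_le_expn n b : n ^_ b <= n ^ b.
Proof.
elim: b => // b IH; rewrite ffactnSr expnSr.
by rewrite leq_mul // leq_subr.
Qed.

Lemma expn_le_ffact n b : n ^ b <= (n + b) ^_ b.
Proof.
elim: b => // b IH; rewrite addnS ffactSS expnS.
by rewrite leq_mul // leqW // leq_addr.
Qed.

Local Open Scope ring_scope.
Local Open Scope classical_set_scope.

(** Up to the common factor [b`!], the binomial coefficients of the sampling
    inequality are compared with [b]-th powers; the last hypothesis bounds the
    ratio of their bases. *)
Lemma delta_perm_le (R : realType) m b N n L t (K : R) (Pi : {set gpattern m}) :
    (forall p, p \in Pi -> perm_pattern p) ->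
    (forall p, p \in Pi -> nblocks p = b) ->
    (0 < L)%N -> (b < t)%N -> (t * (L + m) <= n)%N -> (0 < N)%N -> 0 <= K ->
    ((t + N %/ L) * (n + b))%:R <= K * ((t - b) * (N - m))%:R ->
  delta_perm R Pi b N <= K ^+ b * delta_perm R Pi b n.
Proof.
move=> Pi_perm Pi_blocks L_gt0 lt_bt le_n N_gt0 K_ge0 hK.
have D_gt0 l : (0 < 'C(l - m + b, b)%:R :> R) by rewrite ltr0n bin_gt0 leq_addl.
rewrite /delta_perm mulrA ler_pdivrMr // mulrAC ler_pdivlMr //.
set muN := mu_perm Pi N; set mun := mu_perm Pi n.
set DN := 'C(N - m + b, b); set Dn := 'C(n - m + b, b); set Q := (N %/ L)%N in hK.
have pos : 0 < ((t - b) ^ b * b`!)%:R :> R.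
  by rewrite ltr0n muln_gt0 fact_gt0 expn_gt0 subn_gt0 lt_bt.
rewrite -(ler_pM2r pos).
have step1 : (muN * (t - b) ^ b <= mun * (t + Q) ^ b)%N.
  have := mu_perm_sampling Pi_perm Pi_blocks L_gt0 (ltnW lt_bt) le_n N_gt0.
  rewrite -(leq_pmul2r (fact_gt0 b)) -!mulnA !bin_ffact => le_mu.
  apply: leq_trans (leq_trans le_mu _); rewrite leq_mul2l ?ffact_le_expn ?orbT //.
  by apply/orP; right; rewrite -[in leqRHS](subnK (ltnW lt_bt)) expn_le_ffact.
have step2 : (Dn * b`! <= (n + b) ^ b)%N.
  rewrite bin_ffact (leq_trans (ffact_le_expn _ _)) //.
  case: (b) => // b'; rewrite leq_exp2r //.
  by rewrite leq_add2r leq_subr.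
have step3 : ((N - m) ^ b <= DN * b`!)%N by rewrite bin_ffact expn_le_ffact.
apply: (@le_trans _ _ (mun%:R * ((t + Q) * (n + b))%:R ^+ b)).
  rewrite -!natrM -natrX -natrM ler_nat expnMn.
  by have := leq_mul step1 step2; nia.
apply: (@le_trans _ _ (mun%:R * (K * ((t - b) * (N - m))%:R) ^+ b)).
  by apply: ler_wpM2l => //; rewrite lerXn2r ?nnegrE // mulr_ge0.
rewrite exprMn -natrX expnMn natrM.
have -> : K ^+ b * mun%:R * DN%:R * ((t - b) ^ b * b`!)%:R
    = mun%:R * (K ^+ b * (((t - b) ^ b)%:R * (DN * b`!)%:R)) by rewrite !natrM; ring.
by do 3!(apply: ler_wpM2l; rewrite ?exprn_ge0 //); rewrite ler_nat.
Qed.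

Lemma expr1D_small (R : realType) d (e : R) :
  0 < e -> exists2 x : R, 0 < x & (1 + x) ^+ d <= 1 + e.
Proof.
elim: d e => [|d IH] e e0; first by exists 1; rewrite ?expr0; lra.
have [|x x0 hx] := IH (e / 2); first by lra.
(* [e / (2 + e)] is the solution of (1 + y) (1 + e / 2) = 1 + e. *)
pose y := Num.min x (e / (2 + e)).
have y0 : 0 < y by rewrite lt_min x0 divr_gt0 //; lra.
have yx : y <= x by rewrite ge_min lexx.
have ye : y * (2 + e) <= e by rewrite -ler_pdivlMr ?ge_min ?lexx ?orbT //; lra.
exists y => //; rewrite exprS.
have : (1 + y) ^+ d <= 1 + e / 2 by apply: le_trans hx; rewrite lerXn2r ?nnegrE; lra.
have : 0 <= (1 + y) ^+ d by apply: exprn_ge0; lra.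
by nra.
Qed.

(** With 1 + e bounded below by (1 + x) ^ (3 b), one factor 1 + x absorbs each
    of the errors: m against L (overlap of the windows), b and 1 against t
    (binomial coefficient and rounding of n), and t L and m against N. *)
Lemma delta_perm_almost_decr (R : realType) m b (Pi : {set gpattern m}) (e : R) :
    (forall p, p \in Pi -> perm_pattern p) ->
    (forall p, p \in Pi -> nblocks p = b) -> 0 < e ->
  exists n0, forall n, (n0 <= n)%N -> exists N0, forall N, (N0 <= N)%N ->
    delta_perm R Pi b N <= (1 + e) * delta_perm R Pi b n.
Proof.
move=> Pi_perm Pi_blocks e0.
have [x x0 hx] := @expr1D_small R (3 * b) e e0.
have large (c : R) : exists k : nat, forall l, (k <= l)%N -> c <= x * l%:R.
  exists (Num.bound (c / x)) => l le_l.
  have [c0|c0] := ltP c 0; first by rewrite (le_trans (ltW c0)) // mulr_ge0 // ltW.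
  rewrite mulrC -ler_pdivrMr //.
  apply: le_trans (ltW (archi_boundP _)) _; first exact: divr_ge0 c0 (ltW x0).
  by rewrite ler_nat.
have [L' hL'] := large m%:R; pose L := L'.+1.
have hL : m%:R <= x * L%:R by apply: hL'.
have L_gt0 : 0 < L%:R :> R by rewrite ltr0n.
have [t0 ht0] := large (1 + b%:R + (1 + x) * b%:R).
exists ((t0 + b.+1) * (L + m))%N => n le_n.
pose t := (n %/ (L + m))%N.
have le_t : (t0 + b.+1 <= t)%N by rewrite leq_divRL.
have lt_bt : (b < t)%N by lia.
have ht : 1 + b%:R + (1 + x) * b%:R <= x * t%:R by apply: ht0; lia.
have [N0 hN0] := large ((t * L)%:R + (1 + x) * m%:R).
exists (N0 + m).+1 => N le_N.
have hN : (t * L)%:R + (1 + x) * m%:R <= x * N%:R by apply: hN0; lia.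
apply: le_trans (ler_wpM2r _ hx); last by rewrite divr_ge0.
rewrite exprM; apply: (@delta_perm_le R m b N n L t) => //.
- exact: leq_trunc_div.
- by lia.
- by apply: exprn_ge0; lra.
rewrite -(ler_pM2r L_gt0) !natrM.
have tb : (t - b)%:R = t%:R - b%:R :> R by rewrite natrB // ltnW.
have Nm : (N - m)%:R = N%:R - m%:R :> R by rewrite natrB //; lia.
have bound1 : (t + N %/ L)%:R * L%:R <= (1 + x) * (N - m)%:R.
  apply: (@le_trans _ _ ((t * L)%:R + N%:R)); last by rewrite Nm; lra.
  by rewrite -natrM -natrD ler_nat mulnDl leq_add2l leq_trunc_div.
have bound2 : (n + b)%:R <= ((1 + x) * (t - b)%:R) * ((1 + x) * L%:R).
  apply: (@le_trans _ _ ((t + 1 + b)%:R * (L + m)%:R)).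
    rewrite -natrM ler_nat; have := ltn_ceil n (isT : (0 < L + m)%N).
    by rewrite -/t; nia.
  apply: ler_pM => //; last by rewrite natrD; lra.
  by rewrite !natrD tb; lra.
have := ler_pM (mulr_ge0 (ler0n _ _) (ler0n _ _)) (ler0n _ _) bound1 bound2.
by apply: etrans; congr (_ <= _); ring.
Qed.

(** The limit is the limit superior, written as the infimum of the eventual
    upper bounds: by almost monotonicity, (1 + e) u n is such a bound for every
    large n, which keeps u n from being much smaller than the limit superior. *)
Lemma cvgn_almost_decr (R : realType) (u : nat -> R) :
    (forall n, 0 <= u n) ->
    (forall e, 0 < e -> exists n0, forall n, (n0 <= n)%N ->
      exists N0, forall N, (N0 <= N)%N -> u N <= (1 + e) * u n) ->
  cvgn u.
Proof.
move=> u_ge0 decr.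
pose S := [set x | exists N0, forall N, (N0 <= N)%N -> u N <= x].
have S_inf : has_inf S.
  split; last by exists 0 => x [N0 /(_ _ (leqnn _))]; exact: le_trans.
  by have [n0 /(_ _ (leqnn _)) hn0] := decr 1 ltr01; exists ((1 + 1) * u n0).
have l_ge0 : 0 <= inf S.
  apply: lb_le_inf; first by case: S_inf.
  by move=> x [N0 /(_ _ (leqnn _))]; exact: le_trans.
apply/cvg_ex; exists (inf S); apply/cvgrPdist_lt => e e0.
have [x [N1 hN1] lt_x] := inf_adherent e0 S_inf.
(* This relative error costs less than [e] at the height of the limit. *)
have d0 : 0 < e / (inf S + 1) by rewrite divr_gt0 //; lra.
have [n0 hn0] := decr _ d0.
exists (maxn n0 N1) => // n /=; rewrite geq_max => /andP[le_n0 le_N1].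
have l_le : inf S <= (1 + e / (inf S + 1)) * u n.
  by apply: ge_inf; [case: S_inf | exact: hn0].
have := hN1 n le_N1; rewrite ltr_norml.
have dE : e / (inf S + 1) * (inf S + 1) = e by rewrite divfK // gt_eqF //; lra.
set d := e / _ in d0 l_le dE.
move=> le_x; apply/andP; split; first by lra.
rewrite ltNge; apply/negP => le_un.
have : (1 + d) * u n <= (1 + d) * (inf S - e) by rewrite ler_pM2l; lra.
by nra.
Qed.

Theorem theorem3p2 (R : realType) (m b : nat) (Pi : {set gpattern m})
    (Pi_perm : forall p, p \in Pi -> perm_pattern p)
    (Pi_blocks : forall p, p \in Pi -> nblocks p = b) :
  [/\ forall n, (m <= n)%N -> cvgn (fun k => delta R Pi b k n),
      cvgn (fun n => limn (fun k => delta R Pi b k n)),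
      cvgn (fun n => delta_perm R Pi b n)
    & packing_density R Pi b = limn (fun n => delta_perm R Pi b n)].
Proof.
have cvg_delta n : (fun k => delta R Pi b k n) @ \oo --> delta_perm R Pi b n.
  apply: cvg_near_cst; exists n => // k /= le_nk.
  by rewrite /delta mu_eq_mu_perm.
have lim_delta : (fun n => limn (fun k => delta R Pi b k n)) = delta_perm R Pi b.
  by apply/funext => n; exact/cvg_lim.
have cvg_perm : cvgn (delta_perm R Pi b).
  apply: cvgn_almost_decr; first by move=> n; rewrite divr_ge0.
  by move=> e; exact: delta_perm_almost_decr.
split=> //.
- by move=> n _; apply/cvg_ex; exists (delta_perm R Pi b n).
- by rewrite lim_delta.
- by rewrite /packing_density lim_delta.
Qed.
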